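(* Let $\Lambda$ be a finite set of $N_s\ge2$ sites, let $t>0$ and $\lambda_x>0$ for each $x\in\Lambda$, and consider the Hubbard model with hopping matrix $t_{x,y}=t\lambda_x\lambda_y$ (for all $x,y\in\Lambda$, including $x=y$) and electron number $N_e=N_s-1$. Then for any $U>0$ the ground states of $H$ in $\mathcal H_{N_e}$ have total spin $S_{\rm tot}=S_{\max}=N_e/2$ and are nondegenerate apart from the trivial $(2S_{\max}+1)$-fold degeneracy, i.e. the ground-state eigenspace has dimension exactly $2S_{\max}+1$ and every ground state has $S_{\rm tot}=S_{\max}$.
   Context: For $x\in\Lambda$, $\sigma\in\{\uparrow,\downarrow\}$, $c_{x,\sigma}$ are fermion annihilation operators with $\{c^\dagger_{x,\sigma},c_{y,\tau}\}=\delta_{x,y}\delta_{\sigma,\tau}$, $\{c_{x,\sigma},c_{y,\tau}\}=\{c^\dagger_{x,\sigma},c^\dagger_{y,\tau}\}=0$, vacuum $\Phi_{\rm vac}$ with $c_{x,\sigma}\Phi_{\rm vac}=0$; $\mathcal H_{N_e}$ is the span of $c^\dagger_{x_1,\sigma_1}\cdots c^\dagger_{x_{N_e},\sigma_{N_e}}\Phi_{\rm vac}$. $n_{x,\sigma}=c^\dagger_{x,\sigma}c_{x,\sigma}$. The Hubbard Hamiltonian is $H=\sum_{x,y\in\Lambda}\sum_\sigma t_{x,y}c^\dagger_{x,\sigma}c_{y,\sigma}+U\sum_x n_{x,\uparrow}n_{x,\downarrow}$ on $\mathcal H_{N_e}$. Total spin operators $S^{(\alpha)}_{\rm tot}=\frac12\sum_x\sum_{\sigma,\tau}c^\dagger_{x,\sigma}(p^{(\alpha)})_{\sigma,\tau}c_{x,\tau}$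 (Pauli matrices $p^{(\alpha)}$); a state has total spin $S_{\rm tot}$ if $\sum_\alpha(S^{(\alpha)}_{\rm tot})^2$ acts as $S_{\rm tot}(S_{\rm tot}+1)$; $S_{\max}=N_e/2$ for $N_e\le N_s$. *)

(* Defs.v *)
From HB Require Import structures.
From mathcomp Require Import all_boot all_order all_algebra.
Set Implicit Arguments. Unset Strict Implicit. Unset Printing Implicit Defensive.
Import Order.TTheory GRing.Theory Num.Theory.
Local Open Scope ring_scope.

(* Sites: Lambda = 'I_n (any finite set of N_s = n sites).
   Single-electron modes (x, sigma) with sigma = true for spin up,
   false for spin down. *)
Definition mode (n : nat) := ('I_n * bool)%type.

(* The full Fock space has the occupation-number basis |A> indexed by
   subsets A of modes; |A> corresponds to the ordered product of c^dagger's
   over A (ordered by enum_rank) applied to the vacuum. *)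
Definition dimF (n : nat) : nat := #|{: {set mode n}}|.

Definition st (n : nat) (i : 'I_(dimF n)) : {set mode n} := enum_val i.

Section Ops.
Variables (C : numClosedFieldType) (n : nat).

(* Jordan-Wigner sign: (-1)^(number of occupied modes before m). *)
Definition fsign (A : {set mode n}) (m : mode n) : C :=
  (-1) ^+ #|[set k in A | (enum_rank k < enum_rank m)%N]|.

(* Operators are matrices in "row convention": row i is the image of the
   basis state |st i>, i.e. (M i j) = <st j| O |st i>, and an operator acts
   on a (row) state vector v by v *m M. *)

Definition cdag (m : mode n) : 'M[C]_(dimF n) :=
  \matrix_(i, j) (if (m \notin st i) && (st j == m |: st i)
                  then fsign (st i) m else 0).

Definition cann (m : mode n) : 'M[C]_(dimF n) :=
  \matrix_(i, j) (if (m \in st i) && (st j == st i :\ m)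
                  then fsign (st i) m else 0).

(* operator product P Q (first apply Q, then P) *)
Definition oprod (P Q : 'M[C]_(dimF n)) : 'M[C]_(dimF n) := Q *m P.

Definition numop (m : mode n) : 'M[C]_(dimF n) := oprod (cdag m) (cann m).

Definition hubbardH (tt : 'I_n -> 'I_n -> C) (U : C) : 'M[C]_(dimF n) :=
  \sum_(x < n) \sum_(y < n) \sum_(s : bool)
      tt x y *: oprod (cdag (x, s)) (cann (y, s))
  + U *: \sum_(x < n) oprod (numop (x, true)) (numop (x, false)).

(* Pauli matrices p^(1), p^(2), p^(3) indexed by spins (true = up first). *)
Definition pauli (a : 'I_3) (s u : bool) : C :=
  match nat_of_ord a with
  | 0 => if s != u then 1 else 0
  | 1 => if s != u then (if s then - 'i else 'i) else 0
  | _ => if s == u then (if s then 1 else -1) else 0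
  end.

Definition Stot (a : 'I_3) : 'M[C]_(dimF n) :=
  2^-1 *: \sum_(x < n) \sum_(s : bool) \sum_(u : bool)
             pauli a s u *: oprod (cdag (x, s)) (cann (x, u)).

Definition Stot2 : 'M[C]_(dimF n) := \sum_(a < 3) oprod (Stot a) (Stot a).

(* projection onto the Ne-electron sector H_{Ne}; its row space is H_{Ne} *)
Definition sectorP (Ne : nat) : 'M[C]_(dimF n) :=
  \matrix_(i, j) (if (i == j) && (#|st i| == Ne) then 1 else 0).

Definition sector_eigenvalue (H : 'M[C]_(dimF n)) (Ne : nat) (E : C) : Prop :=
  exists2 v : 'rV[C]_(dimF n), (v != 0) && (v <= sectorP Ne)%MS
                               & v *m H = E *: v.

Definition is_ground_energy (H : 'M[C]_(dimF n)) (Ne : nat) (E : C) : Prop :=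
  sector_eigenvalue H Ne E /\
  forall e, sector_eigenvalue H Ne e -> E <= e.

Definition groundspace (H : 'M[C]_(dimF n)) (Ne : nat) (E : C)
  : 'M[C]_(dimF n) := (eigenspace H E :&: sectorP Ne)%MS.

End Ops.

(* Main.v *)
Require Import Defs.
From HB Require Import structures.
From mathcomp Require Import all_boot all_order all_algebra.
From mathcomp Require Import ring.
Import Order.TTheory GRing.Theory Num.Theory.
Local Open Scope ring_scope.
Set Implicit Arguments. Unset Strict Implicit. Unset Printing Implicit Defensive.

(** With [a_s = \sum_x lam x c_(x,s)] the Hamiltonian is
    [t \sum_s a_s^* a_s + U \sum_x n_(x,up) n_(x,down)], a sum of nonnegative
    operators, so its zero-energy states are those annihilated by [a_up],
    [a_down] and every double occupancy. In the sector of [n - 1] electrons such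
    a state lives on configurations with a single hole and no doubly occupied
    site, and [a_s v = 0] says exactly that its amplitude, divided by
    [(-1)^x lam x] where [x] is the hole, is unchanged when the hole is
    exchanged with an electron at any other site. All configurations with the
    same number of up spins are connected by such exchanges, so the zero-energy
    space consists of the vectors [g (number of ups) (-1)^x lam x] for arbitrary
    [g]; it has dimension [n], and the spin operators act on it as on the spin
    [(n - 1) / 2] representation. *)

(** * Cardinalities and the enumeration order of pairs *)

Lemma card_ord_lt (n k : nat) :
  (k <= n)%N -> #|[set i : 'I_n | (i < k)%N]| = k.
Proof.
move=> le_kn; rewrite -sum1dep_card -(big_ord_widen n (fun=> 1%N)) //.
by rewrite sum1_card card_ord.
Qed.

(** [prod_enum] lists the pairs row by row: the first component is constant along a row and moves up
    in [enum T1] between rows. *)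
Lemma sorted_enum_prod (T1 T2 : finType) (r : rel T1) :
  transitive r -> reflexive r -> sorted r (enum T1) ->
  sorted (fun p q : T1 * T2 => r p.1 q.1) (enum {: T1 * T2}).
Proof.
move=> r_tr r_refl; rewrite [enum {: T1 * T2}]enumT unlock /= /prod_enum.
set s2 := enum T2; elim: (enum T1) => [|x s IHs] //= xs.
have path_row y l : path (fun p q : T1 * T2 => r p.1 q.1) (x, y) [seq (x, y) | y <- l].
  by elim: l y => //= z l IHl y; rewrite r_refl IHl.
have tr : transitive (fun p q : T1 * T2 => r p.1 q.1) by move=> p q u; apply: r_tr.
rewrite sorted_pairwise // pairwise_cat -!sorted_pairwise // IHs ?(path_sorted xs) //.
rewrite andbT; apply/andP; split; last by case: (s2) => //= y l; apply: path_row.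
apply/allrelP => p q /mapP[y _ ->] /allpairsP[u [us _ ->]] /=.
by move/(order_path_min r_tr)/allP: xs; apply.
Qed.

Lemma enum_rank_lt_index (T : finType) (x y : T) :
  (enum_rank x < enum_rank y)%N = (index x (enum T) < index y (enum T))%N.
Proof.
by rewrite -{2}(enum_rankK x) -{2}(enum_rankK y) !(index_uniq, enum_valK, enum_uniq)
  ?(enum_val_nth x) ?(enum_val_nth y) ?index_uniq ?enum_uniq -?cardE.
Qed.

(** * Fermion signs and the action of the operators on amplitudes *)

Section Fock.
Variables (C : numClosedFieldType) (n : nat).
Implicit Types (A B : {set mode n}) (k m : mode n) (x y z : 'I_n) (s : bool).
Implicit Type v : 'rV[C]_(dimF n).

(** Modes are enumerated site by site, so the rank that fixes the Jordan-Wigner signs respects the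
    order of the sites. *)
Lemma mode_rank_le k m : (enum_rank k < enum_rank m)%N -> (k.1 <= m.1)%N.
Proof.
rewrite enum_rank_lt_index; set r : rel (mode n) := fun p q => (p.1 <= q.1)%N.
have r_tr : transitive r by move=> p q u; apply: leq_trans.
suff sr : sorted r (enum {: mode n}).
  by move/(sorted_ltn_index r_tr sr); apply; rewrite mem_enum.
apply: (@sorted_enum_prod _ _ (fun x y => x <= y)%N) => //.
  by move=> ? ? ?; apply: leq_trans.
by have := iota_sorted 0 n; rewrite -val_enum_ord sorted_map.
Qed.

Lemma mode_rank_lt k m :
  k.1 != m.1 -> (enum_rank k < enum_rank m)%N = (k.1 < m.1)%N.
Proof.
move=> km; apply/idP/idP => [/mode_rank_le|]; first by rewrite leq_eqVlt val_eqE (negPf km).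
apply: contraLR; rewrite -!leqNgt leq_eqVlt => /orP[/eqP/val_inj/enum_rank_inj mk|].
  by rewrite mk eqxx in km.
exact: mode_rank_le.
Qed.

(** Rank order and site order can differ only at the other mode of the same site. That mode is empty
    here, so the sign counts the electrons on earlier sites. *)
Lemma fsign_site A m : (m.1, ~~ m.2) \notin A ->
  fsign C A m = (-1) ^+ #|[set k in A | (k.1 < m.1)%N]|.
Proof.
move=> mA; congr (_ ^+ _); apply: eq_card => k; rewrite !inE.
have [kA /=|//] := boolP (k \in A).
have [km|/mode_rank_lt //] := eqVneq k.1 m.1; rewrite km ltnn.
have [->|nkm] := eqVneq k m; first by rewrite ltnn.
case/negP: mA; move: kA nkm; case: k km => z u /= ->; case: m => y s /=.
rewrite xpair_eqE eqxx /= => uA; suff -> : (u != s) = (u == ~~ s).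
  by move/eqP => <-.
by case: u s {uA} => [] [].
Qed.

Lemma fsignU A m : m \notin A -> fsign C (m |: A) m = fsign C A m.
Proof.
move=> mA; congr (_ ^+ _); apply: eq_card => k; rewrite !inE.
by have [->|] := eqVneq k m; rewrite ?ltnn ?andbF.
Qed.

Lemma fsignD A m : fsign C (A :\ m) m = fsign C A m.
Proof.
congr (_ ^+ _); apply: eq_card => k; rewrite !inE.
by have [->|] := eqVneq k m; rewrite ?ltnn ?andbF.
Qed.

Lemma fsign_sqr A m : fsign C A m * fsign C A m = 1.
Proof. by rewrite -expr2 sqrr_sign. Qed.

Lemma conj_fsign A m : (fsign C A m)^* = fsign C A m.
Proof. exact/conj_Creal/rpred_sign. Qed.

Definition fcoef v A : C := v 0 (enum_rank A).

Lemma fcoefP v w : (forall A, fcoef v A = fcoef w A) <-> v = w.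
Proof.
split=> [vw|-> //]; apply/rowP => i.
by have := vw (enum_val i); rewrite /fcoef enum_valK.
Qed.

Lemma fcoef_sum (I : finType) (P : pred I) (F : I -> 'rV_(dimF n)) A :
  fcoef (\sum_(i | P i) F i) A = \sum_(i | P i) fcoef (F i) A.
Proof. by rewrite /fcoef summxE. Qed.

Lemma fcoefD v w A : fcoef (v + w) A = fcoef v A + fcoef w A.
Proof. by rewrite /fcoef mxE. Qed.

Lemma fcoefZ a v A : fcoef (a *: v) A = a * fcoef v A.
Proof. by rewrite /fcoef mxE. Qed.

Lemma fcoef0 A : fcoef 0 A = 0.
Proof. by rewrite /fcoef mxE. Qed.

Lemma fcoef_mul v (M : 'M[C]_(dimF n)) A :
  fcoef (v *m M) A = \sum_B fcoef v B * M (enum_rank B) (enum_rank A).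
Proof.
rewrite /fcoef mxE (reindex (@enum_rank {set mode n})) //=.
exact/onW_bij/enum_rank_bij.
Qed.

(** In the row convention the amplitude at [A] comes from its only preimage [m |: A]. *)
Lemma fcoef_cann v m A :
  fcoef (v *m cann C m) A =
  if m \in A then 0 else fsign C A m * fcoef v (m |: A).
Proof.
rewrite fcoef_mul; case: ifP => mA.
  rewrite big1 // => B _; rewrite mxE /st !enum_rankK.
  by case: ifP; rewrite ?mulr0 // => /andP[mB /eqP AB]; rewrite AB !inE eqxx in mA.
rewrite (bigD1 (m |: A)) //= mxE /st !enum_rankK setU1K ?mA // eqxx setU11 /=.
rewrite fsignU ?mA // big1 ?addr0 1?mulrC // => B BA.
rewrite mxE /st !enum_rankK; case: ifP; rewrite ?mulr0 // => /andP[mB /eqP AB].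
by rewrite AB setD1K ?eqxx // in BA.
Qed.

Lemma fcoef_cdag v m A :
  fcoef (v *m cdag C m) A =
  if m \in A then fsign C A m * fcoef v (A :\ m) else 0.
Proof.
rewrite fcoef_mul; case: ifP => mA; last first.
  rewrite big1 // => B _; rewrite mxE /st !enum_rankK.
  by case: ifP; rewrite ?mulr0 // => /andP[mB /eqP AB]; rewrite AB setU11 in mA.
rewrite (bigD1 (A :\ m)) //= mxE /st !enum_rankK setD1K // eqxx !inE eqxx /=.
rewrite fsignD big1 ?addr0 1?mulrC // => B BA.
rewrite mxE /st !enum_rankK; case: ifP; rewrite ?mulr0 // => /andP[mB /eqP AB].
by rewrite AB setU1K ?eqxx // in BA.
Qed.

(** The entries are real, so this makes [cdag] the adjoint of [cann]. *)
Lemma trmx_cann m : (cann C m)^T = cdag C m.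
Proof.
apply/matrixP => i j; rewrite !mxE.
have [/andP[mj /eqP ij]|] := ifP; last have [/andP[mi /eqP ji]|//] := ifP.
  by rewrite ij !inE eqxx setD1K // eqxx fsignD.
by rewrite ji setU11 setU1K // eqxx.
Qed.

Lemma fcoef_numop v m A : fcoef (v *m numop C m) A = if m \in A then fcoef v A else 0.
Proof.
rewrite mulmxA fcoef_cdag fcoef_cann; case: ifP => // mA.
by rewrite !inE eqxx /= fsignD mulrA fsign_sqr mul1r setD1K.
Qed.

(** Both signs count the electrons on the sites before [x], so they cancel. *)
Lemma fcoef_hop v x s A :
  fcoef (v *m (cann C (x, ~~ s) *m cdag C (x, s))) A =
  if ((x, s) \in A) && ((x, ~~ s) \notin A) then
    fcoef v ((x, ~~ s) |: A :\ (x, s)) else 0.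
Proof.
rewrite mulmxA fcoef_cdag fcoef_cann; case: ifP => //= xA.
rewrite !inE xpair_eqE eqxx /=; have -> : (~~ s == s) = false by case: s {xA}.
rewrite /=; have [_|xA'] := boolP ((x, ~~ s) \in A); rewrite ?mulr0 //= mulrA -(fsignD A).
rewrite [fsign C (A :\ (x, s)) (x, s)]fsign_site ?inE ?(negPf xA') ?andbF //.
rewrite [fsign C (A :\ (x, s)) (x, ~~ s)]fsign_site ?inE ?negbK ?eqxx //=.
by rewrite -expr2 sqrr_sign mul1r.
Qed.

Lemma mem_sectorP v Ne :
  (v <= sectorP C n Ne)%MS <-> (forall A, #|A| != Ne -> fcoef v A = 0).
Proof.
have act w A : fcoef (w *m sectorP C n Ne) A = if #|A| == Ne then fcoef w A else 0.
  rewrite fcoef_mul (bigD1 A) //= mxE eqxx /st enum_rankK /= big1 ?addr0 => [|B BA].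
    by case: ifP; rewrite ?mulr1 ?mulr0.
  by rewrite mxE (inj_eq enum_rank_inj) (negPf BA) mulr0.
split=> [/submxP[w ->] A /negPf nA|vA]; first by rewrite act nA.
suff -> : v = v *m sectorP C n Ne by apply: submxMl.
by apply/fcoefP => A; rewrite act; case: eqVneq => // /vA.
Qed.

End Fock.

(** * Configurations with one or two holes *)

Section Configurations.
Variable n : nat.
Implicit Types (A B : {set mode n}) (k m : mode n) (x y z : 'I_n) (s : bool).
Implicit Type S : {set 'I_n}.

Definition single A z := ((z, true) \in A) (+) ((z, false) \in A).
Definition vacant A z := ((z, true) \notin A) && ((z, false) \notin A).
Definition doubly A z := ((z, true) \in A) && ((z, false) \in A).
Definition ups A : {set 'I_n} := [set z | (z, true) \in A].
Definition downs A : {set 'I_n} := [set z | (z, false) \in A].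

Lemma mem_ups A z : (z \in ups A) = ((z, true) \in A).
Proof. by rewrite inE. Qed.

Definition hole A x := vacant A x && [forall z, (z != x) ==> single A z].

Definition two_holes A x y :=
  [&& x != y, vacant A x, vacant A y &
      [forall z, (z != x) && (z != y) ==> single A z]].

Lemma single_nodouble A z : single A z -> ~~ doubly A z.
Proof. by rewrite /single /doubly; do 2 case: (_ \in A). Qed.

Lemma vacant_nodouble A z : vacant A z -> ~~ doubly A z.
Proof. by rewrite /vacant /doubly; do 2 case: (_ \in A). Qed.

Lemma hole_single A x z : hole A x -> single A z = (z != x).
Proof.
case/andP=> Ax /forallP/(_ z); have [->|_ //] := eqVneq z x.
by move: Ax; rewrite /single /vacant; do 2 case: (_ \in A).
Qed.

Lemma hole_nodouble A x z : hole A x -> ~~ doubly A z.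
Proof.
move=> hA; have := hole_single z hA; case/andP: hA => Ax _.
by have [-> _|_] := eqVneq z x; [apply: vacant_nodouble | apply: single_nodouble].
Qed.

Lemma hole_inj A x y : hole A x -> hole A y -> x = y.
Proof.
move=> /hole_single hx /hole_single hy; apply/eqP.
by have := hy x; rewrite hx eqxx => /esym/negbFE.
Qed.

Lemma two_holes_sym A x y : two_holes A x y = two_holes A y x.
Proof.
rewrite /two_holes eq_sym; congr (_ && _); rewrite andbCA; do 2 congr (_ && _).
by apply: eq_forallb => z; rewrite andbC.
Qed.

Lemma two_holes_single A x y z :
  two_holes A x y -> single A z = (z != x) && (z != y).
Proof.
case/and4P=> _ Ax Ay /forallP/(_ z).
have [->|_] := eqVneq z x; last have [->|_ //] := eqVneq z y.
  by move: Ax; rewrite /single /vacant; do 2 case: (_ \in A).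
by move: Ay; rewrite /single /vacant; do 2 case: (_ \in A).
Qed.

Lemma two_holes_nodouble A x y z : two_holes A x y -> ~~ doubly A z.
Proof.
move=> hA; have := two_holes_single z hA; case/and4P: hA => _ Ax Ay _.
have [-> _|_] := eqVneq z x; first exact: vacant_nodouble.
by have [-> _|_] := eqVneq z y; [apply: vacant_nodouble | apply: single_nodouble].
Qed.

(** Annihilation read at [A] brings in the amplitudes at [(y, s) |: A]; the filled site [y] is the
    second hole of [A]. *)
Lemma hole_setU1 A x y s :
  (y, s) \notin A -> hole ((y, s) |: A) x = two_holes A x y.
Proof.
move=> yA; apply/idP/idP => [h|h].
  have sgl z := hole_single z h; case/andP: h => vx _.
  have nxy : x != y.
    by apply/eqP => xy; move: vx; rewrite xy /vacant !inE; case: (s); rewrite eqxx ?andbF.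
  rewrite /two_holes nxy /=; apply/and3P; split.
  - by move: vx; rewrite /vacant !inE !xpair_eqE (negPf nxy).
  - move: (sgl y); rewrite eq_sym nxy /single /vacant !inE !xpair_eqE eqxx /=.
    by move: yA; case: (s) => /negPf -> /=; case: (_ \in A).
  - apply/forallP => z; apply/implyP => /andP[zx zy].
    by move: (sgl z); rewrite zx /single !inE !xpair_eqE (negPf zy).
have sgl z := two_holes_single z h; case/and4P: h => nxy vx vy _.
apply/andP; split; first by move: vx; rewrite /vacant !inE !xpair_eqE (negPf nxy).
apply/forallP => z; apply/implyP => zx; move: (sgl z); rewrite zx /=.
have [->|zy] /= := eqVneq z y; last by rewrite /single !inE !xpair_eqE (negPf zy).
move: vy; rewrite /vacant /single !inE !xpair_eqE eqxx /=.
by case: s {yA}; do 2 case: (_ \in A).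
Qed.

(** Without double occupancy an electron is determined by its site: [fst] is injective on [A]. *)
Lemma card_sites A (P : pred 'I_n) : (forall z, ~~ doubly A z) ->
  #|[set k in A | P k.1]| = #|[set z | single A z && P z]|.
Proof.
move=> nd; have inj : {in [set k in A | P k.1] &, injective fst}.
  move=> [z s] [y u]; rewrite !inE /= => /andP[zA _] /andP[yA _] zy.
  move: yA; rewrite -zy => yA; congr (_, _).
  by have := nd z; rewrite /doubly; case: s u zA yA => [] [] // -> ->.
rewrite -(card_in_imset inj); apply: eq_card => z; rewrite inE.
rewrite /single; apply/imsetP/andP.
  by case=> -[y s]; rewrite inE /= => /andP[yA Py] -> ; split=> //;
     have := nd y; rewrite /doubly; move: yA; case: s => -> /=; case: (_ \in A).
case=> sz Pz; case zt: ((z, true) \in A) sz => /= sz.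
  by exists (z, true); rewrite ?inE ?zt.
by exists (z, false); rewrite ?inE ?sz.
Qed.

Lemma card_single A : (forall z, ~~ doubly A z) -> #|A| = #|[set z | single A z]|.
Proof.
move/(card_sites predT) => eqA; rewrite -[A in LHS](_ : [set k in A | predT k.1] = A).
  by rewrite eqA; apply: eq_card => z; rewrite !inE andbT.
by apply/setP => k; rewrite inE andbT.
Qed.

Lemma card_hole A x : hole A x -> #|A| = n.-1.
Proof.
move=> h; rewrite card_single => [|z]; last exact: hole_nodouble h.
rewrite -[in RHS](card_ord n) -(cardC1 x); apply: eq_card => z.
by rewrite !inE (hole_single _ h).
Qed.

(** The [n - 1] electrons sit on distinct sites and leave exactly one site over, which is neither
    singly nor doubly occupied. *)
Lemma nodouble_hole A :
  (0 < n)%N -> #|A| = n.-1 -> (forall z, ~~ doubly A z) -> exists x, hole A x.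
Proof.
move=> n0 cA nd; have := cardsC [set z | single A z].
rewrite -card_single // cA card_ord => cC.
have /cards1P[x Cx] : #|~: [set z | single A z]| == 1%N.
  by rewrite -(eqn_add2l n.-1) cC addn1 prednK.
have sgl z : single A z = (z != x) by rewrite -in_set1 -Cx !inE negbK.
exists x; apply/andP; split; last by apply/forallP => z; rewrite sgl implybb.
have := sgl x; have := nd x; rewrite eqxx /doubly /vacant /single.
by do 2 case: (_ \in A).
Qed.

Lemma card_ups_downs A x : hole A x -> (#|ups A| + #|downs A|)%N = n.-1.
Proof.
move=> h; have dis : [disjoint ups A & downs A].
  rewrite -setI_eq0; apply/eqP/setP => z; rewrite !inE.
  by have := hole_nodouble z h; rewrite /doubly => /negPf.
rewrite -cardsUI; move: dis; rewrite -setI_eq0 => /eqP ->; rewrite cards0 addn0.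
rewrite -[in RHS](card_ord n) -(cardC1 x); apply: eq_card => z; rewrite !inE.
have := hole_single z h; have := hole_nodouble z h; rewrite /doubly /single => + <-.
by do 2 case: (_ \in A).
Qed.

(** Each of the [y] sites before [y] carries one electron, except [x] if it is among them. *)
Lemma card_before A x y : two_holes A x y ->
  (#|[set k in A | (k.1 < y)%N]| + (x < y))%N = y.
Proof.
move=> h; rewrite (card_sites (fun z => z < y)%N) => [|z]; last exact: two_holes_nodouble h.
rewrite -[in RHS](card_ord_lt (ltnW (ltn_ord y))) [in RHS](cardsD1 x) inE addnC.
congr (_ + _)%N; apply: eq_card => z; rewrite !inE (two_holes_single _ h).
by have [->|] := eqVneq z y; rewrite ?ltnn ?andbF //= andbT.
Qed.

(** For [x < y] there are [x] electrons before [x] but only [y - 1] before [y], since the hole [x]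
    is skipped. The resulting minus sign makes the two terms of a pair of holes cancel. *)
Lemma fsign_two_holes (C : numClosedFieldType) A x y s : two_holes A x y ->
  fsign C A (y, s) * (-1) ^+ x = - (fsign C A (x, s) * (-1) ^+ y).
Proof.
move=> h; have [nxy vx vy _] := and4P h.
rewrite !fsign_site /=; last 2 first.
- by case/andP: vx; case: s.
- by case/andP: vy; case: s.
have := card_before h; have h' := h; rewrite two_holes_sym in h'.
have := card_before h'; move: #|_| #|_| => a b.
(* The identity is symmetric under exchange of [x] and [y]. *)
wlog lxy : x y a b nxy {vx vy h h'} / (x < y)%N => [hw|].
  case: (ltnP x y) => [lxy|lyx] hx hy; first by apply: hw; rewrite ?lxy.
  have lyx' : (y < x)%N by rewrite ltn_neqAle lyx andbT eq_sym.
  apply/esym/eqP; rewrite eqr_oppLR; apply/eqP; apply: hw => //; first by rewrite eq_sym.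
  by rewrite ltnNge lyx.
rewrite lxy ltnNge (ltnW lxy) addn0 addn1 => <- <-.
by rewrite exprS; ring.
Qed.

(** The configuration from which the hop of [fcoef_hop] leads to [A]. *)
Definition flip A x s := (x, ~~ s) |: A :\ (x, s).

Lemma mem_flip A x s z u : (x, s) \in A -> (x, ~~ s) \notin A ->
  ((z, u) \in flip A x s) = (if z == x then u == ~~ s else (z, u) \in A).
Proof.
move=> xA xA'; rewrite !inE !xpair_eqE; have [->|zx] //= := eqVneq z x.
by move: xA xA'; case: s u => [] [] xA xA' //=; rewrite ?xA ?(negPf xA').
Qed.

Lemma hole_flip A x s y : (x, s) \in A -> (x, ~~ s) \notin A ->
  hole (flip A x s) y = hole A y.
Proof.
move=> xA xA'; have sgl z : single (flip A x s) z = single A z.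
  rewrite /single !mem_flip //; case: (eqVneq z x) => // ->.
  by move: xA xA'; case: s => /= -> /negPf ->.
congr (_ && _); last by apply: eq_forallb => z; rewrite sgl.
rewrite /vacant !mem_flip //; case: (eqVneq y x) => // ->.
by move: xA xA'; case: (s) => /= -> /negPf ->.
Qed.

Lemma ups_flip_true A x : (x, true) \in A -> (x, false) \notin A ->
  #|ups A| = #|ups (flip A x true)|.+1.
Proof.
move=> xA xA'; rewrite (cardsD1 x) inE xA; congr _.+1; apply: eq_card => z.
by rewrite in_setD1 !mem_ups mem_flip //; case: (eqVneq z x).
Qed.

Lemma ups_flip_false A x : (x, false) \in A -> (x, true) \notin A ->
  #|ups (flip A x false)| = #|ups A|.+1.
Proof.
move=> xA xA'; rewrite (cardsD1 x) mem_ups mem_flip // eqxx; congr _.+1.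
apply: eq_card => z; rewrite in_setD1 !mem_ups mem_flip //.
by case: (eqVneq z x) => // ->; rewrite (negPf xA').
Qed.

(** Parametrises the one-hole configurations by the hole and the set of up spins, bijectively once
    [x \notin S]. *)
Definition conf x S : {set mode n} :=
  [set m | (m.1 != x) && (m.2 == (m.1 \in S))].

Lemma conf_ups A x : hole A x -> A = conf x (ups A) /\ x \notin ups A.
Proof.
move=> h; have /andP[/andP[xt xf] _] := h; split; last by rewrite inE.
apply/setP => -[z s]; rewrite !inE /=; have [->|zx] /= := eqVneq z x.
  by case: s; rewrite ?(negPf xt) ?(negPf xf).
have := hole_single z h; rewrite zx /single.
by case: s; do 2 case: (_ \in A).
Qed.

Lemma hole_conf x S : hole (conf x S) x.
Proof.
apply/andP; split; first by rewrite /vacant !inE /= eqxx.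
by apply/forallP => z; apply/implyP => zx; rewrite /single !inE /= zx; case: (z \in S).
Qed.

Lemma ups_conf x S : x \notin S -> ups (conf x S) = S.
Proof.
move=> xS; apply/setP => z; rewrite !inE /=.
by have [->|_] := eqVneq z x; rewrite ?(negPf xS) //=; case: (z \in S).
Qed.

End Configurations.

(** * Spin-symmetric one-hole states and the total spin *)

Section Model.
Variables (C : numClosedFieldType) (n : nat) (lam : 'I_n -> C).
Implicit Types (A B : {set mode n}) (x y z : 'I_n) (s : bool) (S : {set 'I_n}).
Implicit Types (v w : 'rV[C]_(dimF n)) (g h : nat -> C).

(** By [hole_inj] the sum has at most one term; it gives 0 off the one-hole configurations without
    any choice of a hole. *)
Definition amp A : C := \sum_(x | hole A x) (-1) ^+ x * lam x.

Lemma amp_hole A x : hole A x -> amp A = (-1) ^+ x * lam x.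
Proof.
move=> h; apply: big_pred1 => y; apply/idP/eqP => [hy|-> //].
exact: hole_inj hy h.
Qed.

Lemma ampP A : amp A = 0 \/ exists x, hole A x.
Proof.
have [x hx|no] := pickP (hole A); first by right; exists x.
by left; rewrite /amp big_pred0.
Qed.

(** The states symmetric in the spins: [g k] weights the component with [k] up spins, where only
    [k <= n - 1] occurs. *)
Definition polar g : 'rV[C]_(dimF n) := \row_i (g #|ups (st i)| * amp (st i)).

Lemma fcoef_polar g A : fcoef (polar g) A = g #|ups A| * amp A.
Proof. by rewrite /fcoef mxE /st enum_rankK. Qed.

Lemma polarD g h : polar g + polar h = polar (fun k => g k + h k).
Proof. by apply/fcoefP => A; rewrite fcoefD !fcoef_polar mulrDl. Qed.

Lemma polarZ a g : a *: polar g = polar (fun k => a * g k).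
Proof. by apply/fcoefP => A; rewrite fcoefZ !fcoef_polar mulrA. Qed.

Lemma eq_polar g h : (forall A x, hole A x -> g #|ups A| = h #|ups A|) ->
  polar g = polar h.
Proof.
move=> gh; apply/fcoefP => A; rewrite !fcoef_polar.
by have [->|[x /gh ->]] := ampP A; rewrite ?mulr0.
Qed.

(** [hop true false] and [hop false true] are the spin raising and lowering operators; [hop s s]
    counts the electrons of spin [s]. *)
Definition hop s u : 'M[C]_(dimF n) := \sum_x cann C (x, u) *m cdag C (x, s).

(** A spin flip keeps the hole, hence [amp], and shifts the number of up spins by one, so all
    flippable sites contribute equally. *)
Lemma fcoef_polar_hop g s A :
  fcoef (polar g *m hop s (~~ s)) A =
  #|[set x | ((x, s) \in A) && ((x, ~~ s) \notin A)]|%:R *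
  (g (if s then #|ups A|.-1 else #|ups A|.+1) * amp A).
Proof.
rewrite mulmx_sumr fcoef_sum -sumr_const mulr_suml (big_mkcond (fun x => x \in _)) /=.
apply: eq_bigr => x _; rewrite fcoef_hop inE; case: ifP => // /andP[xA xA'].
rewrite mul1r fcoef_polar; congr (g _ * _); last first.
  by apply: eq_bigl => y; apply: hole_flip.
by case: s xA xA' => xA xA'; rewrite ?(ups_flip_true xA xA') ?ups_flip_false.
Qed.

Lemma natr_downs A x : hole A x -> #|downs A|%:R = n.-1%:R - #|ups A|%:R :> C.
Proof. by move=> h; rewrite -(card_ups_downs h) natrD addrAC subrr add0r. Qed.

(** Any of the [k] up spins may be the one just raised. At [k = 0] the factor kills the meaningless
    value [g 0.-1]. *)
Lemma polar_raise g :
  polar g *m hop true false = polar (fun k => k%:R * g k.-1).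
Proof.
apply/fcoefP => A; rewrite (fcoef_polar_hop g true) fcoef_polar mulrA /=.
have [->|[x h]] := ampP A; first by rewrite !mulr0.
congr (_%:R * _ * _); apply: eq_card => z; rewrite !inE /=.
by have := hole_nodouble z h; rewrite /doubly; do 2 case: (_ \in A).
Qed.

(** The flippable sites are now the [n - 1 - k] down spins; at [k = n - 1] the factor vanishes, so
    [g n] has no effect. *)
Lemma polar_lower g :
  polar g *m hop false true = polar (fun k => (n.-1%:R - k%:R) * g k.+1).
Proof.
apply/fcoefP => A; rewrite (fcoef_polar_hop g false) fcoef_polar mulrA /=.
have [->|[x h]] := ampP A; first by rewrite !mulr0.
rewrite -(natr_downs h); congr (_%:R * _ * _); apply: eq_card => z; rewrite !inE /=.
by have := hole_nodouble z h; rewrite /doubly; do 2 case: (_ \in A).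
Qed.

Lemma fcoef_hop_diag v s A :
  fcoef (v *m hop s s) A = #|[set x | (x, s) \in A]|%:R * fcoef v A.
Proof.
rewrite mulmx_sumr fcoef_sum -sumr_const mulr_suml (big_mkcond (fun x => x \in _)) /=.
by apply: eq_bigr => x _; rewrite (fcoef_numop v (x, s)) inE mul1r.
Qed.

Lemma polar_ups g : polar g *m hop true true = polar (fun k => k%:R * g k).
Proof. by apply/fcoefP => A; rewrite fcoef_hop_diag !fcoef_polar mulrA. Qed.

Lemma polar_downs g :
  polar g *m hop false false = polar (fun k => (n.-1%:R - k%:R) * g k).
Proof.
apply/fcoefP => A; rewrite fcoef_hop_diag !fcoef_polar mulrA.
by have [->|[x h]] := ampP A; rewrite ?mulr0 // -(natr_downs h).
Qed.

Lemma Stot_hop a :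
  Stot C n a = 2^-1 *: \sum_s \sum_u pauli C a s u *: hop s u.
Proof.
rewrite /Stot exchange_big; congr (_ *: _); apply: eq_bigr => s _.
rewrite exchange_big; apply: eq_bigr => u _.
by rewrite scaler_sumr.
Qed.

Lemma polar_Stot0 g :
  polar g *m Stot C n 0 =
  polar (fun k => 2^-1 * (k%:R * g k.-1 + (n.-1%:R - k%:R) * g k.+1)).
Proof.
rewrite Stot_hop !big_bool /= /pauli /= !scale0r !scale1r add0r addr0.
by rewrite -scalemxAr mulmxDr polar_raise polar_lower polarD polarZ.
Qed.

Lemma polar_Stot1 g :
  polar g *m Stot C n 1 =
  'i *: polar (fun k => 2^-1 * ((n.-1%:R - k%:R) * g k.+1 - k%:R * g k.-1)).
Proof.
rewrite Stot_hop !big_bool /= /pauli /= !scale0r add0r addr0.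
rewrite -scalemxAr mulmxDr -!scalemxAr polar_raise polar_lower !polarZ polarD !polarZ.
by apply: eq_polar => A x _; ring.
Qed.

Lemma polar_Stot2 g :
  polar g *m Stot C n 2 = polar (fun k => 2^-1 * (k%:R - (n.-1%:R - k%:R)) * g k).
Proof.
rewrite Stot_hop !big_bool /= /pauli /= !scale0r add0r addr0 scale1r.
rewrite -scalemxAr mulmxDr -scalemxAr polar_ups polar_downs !polarZ polarD polarZ.
by apply: eq_polar => A x _; ring.
Qed.

(** Double raisings and double lowerings cancel between the first two components. What is left
    multiplies [g k] by a polynomial in [k] that is constant. *)
Lemma polar_Casimir g : let S : C := n.-1%:R / 2 in
  polar g *m Stot2 C n = (S * (S + 1)) *: polar g.
Proof.
move=> S; rewrite /Stot2 !big_ord_recl big_ord0 addr0 /oprod !mulmxDr !mulmxA.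
have -> : lift ord0 ord0 = 1 :> 'I_3 by apply: val_inj.
have -> : lift ord0 (lift ord0 ord0) = 2 :> 'I_3 by apply: val_inj.
rewrite polar_Stot0 polar_Stot0 polar_Stot1 -scalemxAl polar_Stot1 scalerA -expr2 sqrCi.
rewrite !polar_Stot2 !polarZ !polarD /S; apply: eq_polar => A x _.
have two_neq0 : 2%:R != 0 :> C by rewrite pnatr_eq0.
(* [k.-1.+1 = k] fails at [k = 0], where the coefficient of that term vanishes. *)
by case: #|ups A| => [|k] /=; rewrite ?mulrSr; field.
Qed.

(** * The Hamiltonian as a sum of squares *)

Definition ann s : 'M[C]_(dimF n) := \sum_x lam x *: cann C (x, s).

Lemma fcoef_ann v s B : fcoef (v *m ann s) B =
  \sum_y lam y * (if (y, s) \in B then 0 else fsign C B (y, s) * fcoef v ((y, s) |: B)).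
Proof.
rewrite mulmx_sumr fcoef_sum; apply: eq_bigr => y _.
by rewrite -scalemxAr fcoefZ fcoef_cann.
Qed.

Lemma ups_setU1 B y s : vacant B y -> #|ups ((y, s) |: B)| = (s + #|ups B|)%N.
Proof.
case/andP=> yt _; rewrite (cardsD1 y) !inE xpair_eqE eqxx (negPf yt) orbF.
congr (_ + _)%N.
apply: eq_card => z; rewrite !inE xpair_eqE; have [->|] //= := eqVneq z y.
by rewrite (negPf yt).
Qed.

(* Each pair of holes of B contributes twice, with opposite Jordan-Wigner signs. *)
Lemma polar_ann g s : polar g *m ann s = 0.
Proof.
apply/fcoefP => B; rewrite fcoef_ann fcoef0.
pose F y x := lam y * fsign C B (y, s) * g (s + #|ups B|)%N * ((-1) ^+ x * lam x).
transitivity (\sum_y \sum_(x | two_holes B x y) F y x).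
  apply: eq_bigr => y _; case: ifP => yB.
    rewrite mulr0 big_pred0 // => x; apply/negbTE; apply: contraL yB.
    by case/and4P=> _ _ /andP[]; case: s {F}.
  rewrite fcoef_polar /amp !mulr_sumr; apply: eq_big => x.
    by rewrite hole_setU1 ?yB.
  by rewrite hole_setU1 ?yB // => /and4P[_ _ vy _]; rewrite ups_setU1 // /F !mulrA.
apply/eqP; rewrite -eqNr; apply/eqP.
rewrite [RHS](exchange_big_dep xpredT) //= -sumrN; apply: eq_bigr => y _.
rewrite -sumrN; apply: eq_big => x; first by rewrite two_holes_sym.
move=> h; have := fsign_two_holes C s h; rewrite /F => e.
have -> : lam y * fsign C B (y, s) * g (s + #|ups B|)%N * ((-1) ^+ x * lam x) =
  lam x * lam y * g (s + #|ups B|)%N * (fsign C B (y, s) * (-1) ^+ x) by ring.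
by rewrite e; ring.
Qed.

Lemma trmx_ann s : (ann s)^T = \sum_x lam x *: cdag C (x, s).
Proof.
apply/matrixP => i j; rewrite mxE !summxE; apply: eq_bigr => x _.
by rewrite -trmx_cann !mxE.
Qed.

Definition dbl x : 'M[C]_(dimF n) := numop C (x, false) *m numop C (x, true).

Lemma fcoef_dbl v x A : fcoef (v *m dbl x) A = if doubly A x then fcoef v A else 0.
Proof.
by rewrite mulmxA !fcoef_numop /doubly; do 2 case: (_ \in A).
Qed.

(** The hopping matrix has rank one and factors. In the row convention the right factor acts last,
    so [ann s *m (ann s)^T] is [a_s^* a_s]. *)
Lemma hubbardE (t U : C) :
  hubbardH (fun x y => t * lam x * lam y) U =
  t *: (\sum_s ann s *m (ann s)^T) + U *: \sum_x dbl x.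
Proof.
congr (_ + _); under eq_bigr do rewrite exchange_big; rewrite exchange_big.
rewrite scaler_sumr; apply: eq_bigr => s _.
rewrite trmx_ann /ann mulmx_sumr scaler_sumr.
apply: eq_bigr => x _; rewrite mulmx_suml scaler_sumr; apply: eq_bigr => y _.
by rewrite -scalemxAr -scalemxAl !scalerA mulrA.
Qed.

Lemma polar_ground g (t U : C) :
  polar g *m hubbardH (fun x y => t * lam x * lam y) U = 0.
Proof.
rewrite hubbardE mulmxDr -!scalemxAr !mulmx_sumr big1 => [|s _]; last first.
  by rewrite mulmxA polar_ann mul0mx.
rewrite big1 => [|x _]; first by rewrite !scaler0 addr0.
apply/fcoefP => A; rewrite fcoef_dbl fcoef0 fcoef_polar; case: ifP => // dA.
have [->|[y h]] := ampP A; first by rewrite mulr0.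
by have := hole_nodouble x h; rewrite dA.
Qed.

Lemma polar_sector g : (polar g <= sectorP C n n.-1)%MS.
Proof.
apply/mem_sectorP => A nA; rewrite fcoef_polar.
have [->|[y h]] := ampP A; first by rewrite mulr0.
by rewrite (card_hole h) eqxx in nA.
Qed.

(** * Positivity of the energy *)

Hypothesis lam_gt0 : forall x, 0 < lam x.

Lemma weight_neq0 x : (-1) ^+ x * lam x != 0.
Proof. by rewrite mulf_neq0 ?signr_eq0 ?gt_eqF. Qed.

Definition sqnorm v : C := \sum_A fcoef v A * (fcoef v A)^*.

Lemma sqnorm_ge0 v : 0 <= sqnorm v.
Proof. by apply: sumr_ge0 => A _; apply: mul_conjC_ge0. Qed.

Lemma sqnorm_eq0 v : sqnorm v = 0 -> v = 0.
Proof.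
move=> v0; apply/fcoefP => A; rewrite fcoef0; apply/eqP.
rewrite -mul_conjC_eq0; apply/eqP; apply: psumr_eq0P v0 A isT.
by move=> A _; apply: mul_conjC_ge0.
Qed.

Lemma sqnormE v : sqnorm v = (v *m (map_mx Num.conj v)^T) 0 0.
Proof.
rewrite /sqnorm mxE (reindex (@enum_rank {set mode n})) /=; last first.
  exact/onW_bij/enum_rank_bij.
by apply: eq_bigr => A _; rewrite !mxE.
Qed.

(** With [lam] and the signs real, the transpose in [hubbardE] is the adjoint. *)
Lemma conj_ann s : map_mx Num.conj (ann s) = ann s.
Proof.
apply/matrixP => i j; rewrite mxE !summxE rmorph_sum; apply: eq_bigr => x _.
rewrite !mxE rmorphM /= (conj_Creal (ger0_real (ltW (lam_gt0 x)))); congr (_ * _).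
by case: ifP; rewrite ?conj_fsign ?conjC0.
Qed.

(** Pairing the eigenvalue equation with the conjugate of [v] turns the summands of the Hamiltonian
    into squared norms. *)
Lemma energyE v (t U e : C) :
  v *m hubbardH (fun x y => t * lam x * lam y) U = e *: v ->
  e * sqnorm v = t * (\sum_s sqnorm (v *m ann s))
    + U * \sum_x \sum_(A | doubly A x) fcoef v A * (fcoef v A)^*.
Proof.
move=> vH; set w := (map_mx Num.conj v)^T.
have -> : e * sqnorm v = ((e *: v) *m w) 0 0 by rewrite sqnormE -scalemxAl [RHS]mxE.
rewrite -vH hubbardE mulmxDr mulmxDl mxE -!scalemxAr -!scalemxAl.
rewrite [X in X + _]mxE [X in _ + X]mxE; congr (_ * _ + _ * _).
  rewrite mulmx_sumr mulmx_suml summxE; apply: eq_bigr => s _.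
  by rewrite sqnormE map_mxM conj_ann trmx_mul !mulmxA.
rewrite mulmx_sumr mulmx_suml summxE; apply: eq_bigr => x _.
rewrite mxE (reindex (@enum_rank {set mode n})) /=; last first.
  exact/onW_bij/enum_rank_bij.
rewrite [RHS]big_mkcond; apply: eq_bigr => A _.
have := fcoef_dbl v x A; rewrite /fcoef => ->.
by case: ifP; rewrite ?mul0r // /w !mxE.
Qed.

Lemma energy_ge0 v (t U e : C) : 0 < t -> 0 < U -> v != 0 ->
  v *m hubbardH (fun x y => t * lam x * lam y) U = e *: v -> 0 <= e.
Proof.
move=> t0 U0 v0 /energyE en; have nv : 0 < sqnorm v.
  rewrite lt_neqAle sqnorm_ge0 andbT eq_sym; apply: contra v0 => /eqP.
  by move/sqnorm_eq0 => ->.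
rewrite -(pmulr_lge0 _ nv) en addr_ge0 ?mulr_ge0 ?(ltW t0) ?(ltW U0) //.
  by apply: sumr_ge0 => s _; apply: sqnorm_ge0.
by apply: sumr_ge0 => x _; apply: sumr_ge0 => A _; apply: mul_conjC_ge0.
Qed.

(** The energy is a sum of nonnegative terms with positive coefficients [t] and [U]; if it is zero,
    every term is. *)
Lemma zero_energy v (t U : C) : 0 < t -> 0 < U ->
  v *m hubbardH (fun x y => t * lam x * lam y) U = 0 ->
  (forall s, v *m ann s = 0) /\ (forall A x, doubly A x -> fcoef v A = 0).
Proof.
move=> t0 U0 v0; have en : v *m hubbardH (fun x y => t * lam x * lam y) U = 0 *: v.
  by rewrite v0 scale0r.
have s_ge0 s : true -> 0 <= sqnorm (v *m ann s) by move=> _; apply: sqnorm_ge0.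
have A_ge0 x A : doubly A x -> 0 <= fcoef v A * (fcoef v A)^*.
  by move=> _; apply: mul_conjC_ge0.
have x_ge0 x : true -> 0 <= \sum_(A | doubly A x) fcoef v A * (fcoef v A)^*.
  by move=> _; apply: sumr_ge0 => A; apply: A_ge0.
move/energyE: en => /esym/eqP; rewrite mul0r paddr_eq0; last 2 first.
- by rewrite mulr_ge0 ?(ltW t0) ?sumr_ge0.
- by rewrite mulr_ge0 ?(ltW U0) ?sumr_ge0.
rewrite !mulf_eq0 (gt_eqF t0) (gt_eqF U0) /= => /andP[/eqP sK /eqP sD].
split=> [s|A x dA]; first by apply: sqnorm_eq0; apply: psumr_eq0P sK s isT.
have xD := psumr_eq0P x_ge0 sD (i := x) isT.
by apply/eqP; rewrite -mul_conjC_eq0; apply/eqP; apply: (psumr_eq0P (A_ge0 x) xD).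
Qed.

(** * Hole exchanges determine the zero-energy amplitudes *)

Section Kernel.
Variable v : 'rV[C]_(dimF n).
Hypothesis v_doubly : forall A x, doubly A x -> fcoef v A = 0.
Hypothesis v_ann : forall s, v *m ann s = 0.

(** Read at [B], the equation [v *m ann s = 0] keeps only the terms of the two holes, and
    [fsign_two_holes] compares their signs. *)
Lemma hole_exchange B x y s : two_holes B x y ->
  fcoef v ((y, s) |: B) / ((-1) ^+ x * lam x) =
  fcoef v ((x, s) |: B) / ((-1) ^+ y * lam y).
Proof.
move=> h; have := fsign_two_holes C s h.
have := fcoef_ann v s B; rewrite v_ann fcoef0.
have /and4P[nxy vx vy _] := h.
have memF z : vacant B z -> ((z, s) \in B) = false.
  by case/andP=> /negPf zt /negPf zf; case: s.
rewrite (bigD1 y) //= (bigD1 x) //= !memF // big1 ?addr0 => [|z /andP[zy zx]]; last first.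
  (* At a site [z] other than the holes, [(z, s)] is either filled already or would create a double
     occupancy. *)
  case: ifP => zB; rewrite ?mulr0 // (v_doubly (x := z)) ?mulr0 //.
  have := two_holes_single z h; rewrite zx zy /single /doubly !inE !xpair_eqE !eqxx /=.
  by move: zB; case: (s) => /= -> //=; rewrite ?andbT ?addbF ?orbF.
set fy := fsign C B (y, s); set fx := fsign C B (x, s).
set ay := fcoef v _; set ax := fcoef v _ => e0 e1.
have fx2 : fx * fx = 1 by apply: fsign_sqr.
have fy2 : fy * fy = 1 by apply: fsign_sqr.
apply/eqP; rewrite eqr_div ?weight_neq0 //; apply/eqP.
have sx : (-1) ^+ x * (-1) ^+ x = 1 :> C by rewrite -expr2 sqrr_sign.
have sy : (-1) ^+ y * (-1) ^+ y = 1 :> C by rewrite -expr2 sqrr_sign.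
move: e0 e1 sx sy; move: ((-1) ^+ x) ((-1) ^+ y) => px py e0 e1 sx sy.
have e2 : lam y * (fy * ay) = - (lam x * (fx * ax)).
  by apply/eqP; rewrite -addr_eq0 -e0.
(* Inserting [fy * fy = 1] and [px * px = 1] brings out the products rewritten by [e2] and [e1]. *)
have -> : ay * (py * lam y) = (lam y * (fy * ay)) * (fy * px) * (px * py).
  transitivity (ay * (py * lam y) * (fy * fy) * (px * px)); last by ring.
  by rewrite fy2 sx !mulr1.
rewrite e2 e1.
transitivity (ax * (px * lam x) * (fx * fx) * (py * py)); first by ring.
by rewrite fx2 sy !mulr1.
Qed.

(** The amplitude relative to the weight used in [polar]; it will turn out to depend on [#|S|]
    alone. *)
Definition ratio x S : C := fcoef v (conf x S) / ((-1) ^+ x * lam x).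

(** [S'] arises from [S] by carrying the spin at [y] over to [x]. Removing that electron from
    [conf x S] leaves the two-hole configuration [B]; refilling at [x] gives [conf y S']. *)
Lemma ratio_exchange x y S S' : x != y -> x \notin S -> y \notin S' ->
  (x \in S') = (y \in S) -> S :\ y = S' :\ x -> ratio x S = ratio y S'.
Proof.
move=> nxy xS yS' xy SS'; pose B := conf x S :\ (y, y \in S).
have mem z : z != x -> z != y -> (z \in S') = (z \in S).
  by move=> zx zy; have /setP/(_ z) := SS'; rewrite !inE zx zy.
have vac z s : ((z, s) \in B) = [&& z != x, z != y & s == (z \in S)].
  rewrite !inE /= xpair_eqE; have [->|//] := eqVneq z y; rewrite ?andbF //=.
  by case: (s == _); rewrite ?andbF.
have hB : two_holes B x y.
  apply/and4P; split=> //; rewrite /vacant ?vac ?eqxx ?andbF //.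
  apply/forallP => z; apply/implyP => /andP[zx zy].
  by rewrite /single !vac zx zy /=; case: (z \in S).
have -> : ratio x S = fcoef v ((y, y \in S) |: B) / ((-1) ^+ x * lam x).
  by rewrite /ratio setD1K // !inE /= eq_sym nxy eqxx.
rewrite (hole_exchange _ hB) /ratio; congr (fcoef v _ / _).
apply/setP => -[z s]; rewrite in_setU1 vac !inE /= xpair_eqE.
have [->|zx] /= := eqVneq z x; first by rewrite nxy orbF xy.
by have [//|zy] /= := eqVneq z y; rewrite mem.
Qed.

(** The electron exchanged with the hole has spin down, so the set of up spins does not change. *)
Lemma ratio_hole x y S : x \notin S -> y \notin S -> ratio x S = ratio y S.
Proof.
move=> xS yS; have [->//|nxy] := eqVneq x y.
have setD1_id u : u \notin S -> S :\ u = S.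
  by move=> uS; apply/setDidPl; rewrite disjoint_sym disjoints1.
by apply: ratio_exchange; rewrite ?(negPf xS) ?(negPf yS) // !setD1_id.
Qed.

(* Moving the hole out to z and then to y exchanges z and y in the set of up
   spins; such exchanges connect any two sets of equal cardinality. *)
Lemma ratio_card x x' S S' : x \notin S -> x' \notin S' -> #|S| = #|S'| ->
  ratio x S = ratio x' S'.
Proof.
(* Induction on the number of sites of [S] outside [S'], for all [S] and holes [x]. *)
elim: {S}_.+1 {-2}S x (ltnSn #|S :\: S'|) => // d IHd S x dS xS x'S' cSS'.
have [sub|] := boolP (S \subset S').
  have eSS' : S = S' by apply/eqP; rewrite eqEcard sub cSS' leqnn.
  by move: xS; rewrite eSS' => xS; apply: ratio_hole.
move/subsetPn=> [y yS yS'].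
have /subsetPn[z zS' zS] : ~~ (S' \subset S).
  apply: contra yS' => sub; have /eqP -> // : S' == S.
  by rewrite eqEcard sub cSS' leqnn.
have nzy : z != y by apply: contraNneq zS => ->.
pose S1 := z |: S :\ y.
have yS1 : y \notin S1 by rewrite !inE eqxx eq_sym (negPf nzy).
have -> : ratio x S = ratio y S1.
  rewrite (ratio_hole xS zS); apply: ratio_exchange => //.
    by rewrite yS setU11.
  by rewrite setU1K // !inE (negPf zS) andbF.
apply: IHd => //.
  rewrite -ltnS; apply: leq_trans dS; rewrite ltnS; apply/proper_card/properP; split.
    apply/subsetP => u; rewrite !inE => /andP[uS'].
    by rewrite uS' => /orP[/eqP uz|/andP[_ ->] //]; rewrite uz zS' in uS'.
  by exists y; rewrite ?inE ?yS ?yS' // eqxx eq_sym (negPf nzy).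
by rewrite -cSS' (cardsD1 y S) yS cardsU1 !inE (negPf zS) andbF.
Qed.

Lemma kernel_polar : (0 < n)%N -> (v <= sectorP C n n.-1)%MS ->
  exists g, v = polar g.
Proof.
move=> n0 /mem_sectorP vs; have ltn1 : (n.-1 < n)%N by rewrite prednK.
(* Reference configurations: hole at the last site, up spins on the first [k] sites, which avoid the
   hole for [k <= n - 1]. *)
pose S0 k : {set 'I_n} := [set i : 'I_n | (i < k)%N]; pose x0 := Ordinal ltn1.
exists (fun k => ratio x0 (S0 k)); apply/fcoefP => A; rewrite fcoef_polar.
have [|noh] := pickP (hole A).
  move=> x hx; rewrite (amp_hole hx); have [eA xA] := conf_ups hx.
  have le_ups : (#|ups A| <= n.-1)%N by rewrite -(card_ups_downs hx) leq_addr.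
  rewrite -(ratio_card xA) ?card_ord_lt ?inE -?leqNgt ?(leq_trans le_ups) ?leq_pred //.
  by rewrite /ratio -eA mulfVK ?weight_neq0.
(* Without a hole, [A] has the wrong number of electrons or a doubly occupied site. *)
rewrite /amp big_pred0 // mulr0.
have [cA|] := eqVneq #|A| n.-1; last exact: vs.
have [x dA|nod] := pickP (doubly A); first exact: v_doubly dA.
have [|x hx] := nodouble_hole n0 cA; first by move=> z; rewrite nod.
by rewrite noh in hx.
Qed.

End Kernel.

Lemma ground_polar v (t U : C) : (0 < n)%N -> 0 < t -> 0 < U ->
  v *m hubbardH (fun x y => t * lam x * lam y) U = 0 ->
  (v <= sectorP C n n.-1)%MS -> exists g, v = polar g.
Proof.
move=> n0 t0 U0 /(zero_energy t0 U0)[vK vD]; exact: kernel_polar.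
Qed.

(** * The dimension of the zero-energy space *)

Lemma polar_conf g x S :
  x \notin S -> fcoef (polar g) (conf x S) = g #|S| * ((-1) ^+ x * lam x).
Proof.
by move=> xS; rewrite fcoef_polar ups_conf // (amp_hole (hole_conf x S)).
Qed.

(** Row [k] is the state with exactly [k] up spins; the values [0] to [n - 1] give the [n] members
    of the multiplet of spin [(n - 1) / 2]. *)
Definition ladder : 'M[C]_(n, dimF n) := \matrix_(k < n) polar (fun j => (j == k)%:R).

(** Values of [g] from [n] on do not matter, since [n - 1] electrons have at most [n - 1] up
    spins. *)
Lemma mul_ladder (u : 'rV[C]_n) g :
  (forall k : 'I_n, u 0 k = g k) -> u *m ladder = polar g.
Proof.
move=> ug; apply/fcoefP => A; rewrite fcoef_polar /fcoef mxE /=.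
have -> : \sum_j u 0 j * ladder j (enum_rank A) =
    \sum_(j < n) g j * ((#|ups A| == j)%:R * amp A).
  by apply: eq_bigr => k _; rewrite ug !mxE /st enum_rankK.
have [a0|[x h]] := ampP A; first by rewrite a0 mulr0 big1 // => k _; rewrite !mulr0.
have lt_ups : (#|ups A| < n)%N.
  apply: leq_ltn_trans (_ : n.-1 < n)%N; by rewrite ?prednK ?(leq_ltn_trans _ (ltn_ord x)) //
    -(card_ups_downs h) leq_addr.
rewrite (bigD1 (Ordinal lt_ups)) //= eqxx mul1r big1 ?addr0 // => k kA.
suff -> : (#|ups A| == k) = false by rewrite mul0r mulr0.
by apply: contraNF kA => /eqP kA; apply/eqP/val_inj.
Qed.

Lemma ladder_free : row_free ladder.
Proof.
apply: inj_row_free => u u0; apply/rowP => k; rewrite mxE.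
have lt_k := ltn_ord k.
(* Extends [u] to all naturals by the default 0. *)
pose g j := if insub j is Some i then u 0 i else 0.
have gk (i : 'I_n) : u 0 i = g i by rewrite /g valK.
have ltn1 : (n.-1 < n)%N by rewrite prednK // (leq_ltn_trans _ lt_k).
(* With the hole at the last site and the first [k] sites up, the amplitude isolates coordinate [k]
   of [u]. *)
pose S : {set 'I_n} := [set i : 'I_n | (i < k)%N].
have xS : Ordinal ltn1 \notin S.
  by rewrite inE -leqNgt -ltnS prednK // (leq_ltn_trans _ lt_k).
have := polar_conf g xS; rewrite -(mul_ladder gk) u0 fcoef0 card_ord_lt 1?ltnW //.
move/esym/eqP; rewrite mulf_eq0 (negPf (weight_neq0 _)) orbF -gk => /eqP; exact.
Qed.

Lemma ground_energy0 (t U : C) : (0 < n)%N -> 0 < t -> 0 < U ->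
  is_ground_energy (hubbardH (fun x y => t * lam x * lam y) U) n.-1 0.
Proof.
move=> n0 t0 U0; split; last first.
  by move=> e [v /andP[v0 _]]; apply: energy_ge0.
exists (polar (fun=> 1)); last by rewrite polar_ground scale0r.
rewrite polar_sector andbT; apply/eqP => p0.
(* The amplitude with the hole at the first site and all spins down is nonzero. *)
have x0 : Ordinal n0 \notin set0 by rewrite in_set0.
have := polar_conf (fun=> 1) x0; rewrite p0 fcoef0 mul1r => /esym/eqP.
by rewrite (negPf (weight_neq0 _)).
Qed.

Lemma groundspace_ladder (t U : C) : (0 < n)%N -> 0 < t -> 0 < U ->
  (groundspace (hubbardH (fun x y => t * lam x * lam y)%R U) n.-1 0%R :=: ladder)%MS.
Proof.
move=> n0 t0 U0; apply/eqmxP/andP; split.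
  apply/rV_subP => v; rewrite sub_capmx => /andP[/eigenspaceP].
  rewrite scale0r => vH vS; have [g ->] := ground_polar n0 t0 U0 vH vS.
  by rewrite -(@mul_ladder (\row_k g k)) ?submxMl // => k; rewrite mxE.
apply/row_subP => k; rewrite rowK sub_capmx polar_sector andbT.
by apply/eigenspaceP; rewrite polar_ground scale0r.
Qed.

End Model.

(** * Energy, degeneracy and total spin of the ground states *)

Theorem mainTheorem7 (C : numClosedFieldType) (n : nat) (t : C)
    (lam : 'I_n -> C) (U : C) :
  (2 <= n)%N -> 0 < t -> (forall x, 0 < lam x) -> 0 < U ->
  let Ne := n.-1 in
  let Smax : C := Ne%:R / 2 in
  let H := hubbardH (fun x y => t * lam x * lam y) U in
  (exists E, is_ground_energy H Ne E) /\
  forall E, is_ground_energy H Ne E ->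
    \rank (groundspace H Ne E) = Ne.+1 /\
    forall v : 'rV[C]_(dimF n), (v <= groundspace H Ne E)%MS ->
      v *m Stot2 C n = (Smax * (Smax + 1)) *: v.
Proof.
move=> n2 t0 lam0 U0 Ne Smax H; have n0 : (0 < n)%N by apply: ltnW.
have gs0 : is_ground_energy H Ne 0 by apply: ground_energy0.
split=> [|E [evE minE]]; first by exists 0.
(* Both energies are attained and minimal, so each bounds the other. *)
have -> : E = 0.
  by apply/le_anti/andP; split; [apply: minE (proj1 gs0) | apply: (proj2 gs0)].
split=> [|v vG].
  rewrite (groundspace_ladder lam0 n0 t0 U0) prednK //.
  exact/eqP/(ladder_free lam0).
move: vG; rewrite sub_capmx => /andP[/eigenspaceP]; rewrite scale0r => vH vS.
have [g ->] := ground_polar lam0 n0 t0 U0 vH vS.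
exact: polar_Casimir.
Qed.
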